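(* Let $V$ be a left vector space over a division ring $R$, of finite dimension $n\ge 2$, and let $X$ be a finite subset of $V$ containing more than one vector. Suppose that every permutation of the set $X$ can be extended to a linear automorphism of $V$. Then either $X$ is formed by linearly independent vectors, or $X$ consists of $$x_{1},\dots,x_{m},\,-(x_{1}+\dots+x_{m}),$$ where $x_{1},\dots,x_{m}$ are linearly independent vectors of $V$.
   Context: A permutation $s$ of $X\subset V$ (a bijection $X\to X$) extends to a linear automorphism of $V$ if there is $u\in\mathrm{GL}(V)$ with $u(x)=s(x)$ for all $x\in X$. ''$X$ is formed by linearly independent vectors'' means that the distinct elements of $X$ form a linearly independent family. *)

(* Defs.v *)
From mathcomp Require Import all_boot all_order all_algebra all_fingroup finmap.

Set Implicit Arguments.
Unset Strict Implicit.
Unset Printing Implicit Defensive.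

Import GRing.Theory.
Local Open Scope ring_scope.

(* [fieldType] is commutative; a division ring is a [unitRingType] satisfying
   the field axiom, [GRing.unit] meaning two-sided invertibility. *)
Definition division_ring (R : unitRingType) : Prop := GRing.field_axiom R.

(* [free] from the vector library is only available over a commutative field. *)
Definition lin_indep (R : nzRingType) (V : lmodType R) (I : finType)
    (x : I -> V) : Prop :=
  forall a : I -> R, \sum_i a i *: x i = 0 -> forall i, a i = 0.

Definition lin_indep_fset (R : nzRingType) (V : lmodType R)
    (X : {fset V}) : Prop :=
  lin_indep (fun x : X => fsval x).

Definition extends_to_linear_aut (R : nzRingType) (V : lmodType R)
    (X : {fset V}) (s : {perm X}) : Prop :=
  exists u : {linear V -> V},
    bijective u /\ forall x : X, u (fsval x) = fsval (s x).

(* Main.v *)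
Require Import Defs.
From mathcomp Require Import all_boot all_order all_algebra all_fingroup finmap.

Set Implicit Arguments.
Unset Strict Implicit.
Unset Printing Implicit Defensive.

Import GRing.Theory.
Local Open Scope ring_scope.

(** Apply the extension of the transposition (p q) to a linear relation
    [\sum_x a x *: x = 0] and subtract: this leaves
    [(a p - a q) *: (q - p) = 0], so [a p = a q].  Hence every linear relation
    on [X] has constant coefficients.  If the sum of [X] is nonzero then [X] is
    independent; if it is zero, a relation on [X] minus one vector extends by
    the coefficient 0 to [X], so it is trivial. *)

Lemma division_ring_scaler_eq0 (R : unitRingType) (divR : division_ring R)
    (V : lmodType R) (c : R) (v : V) :
  c *: v = 0 -> v != 0 -> c = 0.
Proof.
move=> cv0 v_neq0; apply/eqP; apply: contraNT v_neq0 => /divR c_unit.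
by rewrite -[v]scale1r -(mulVr c_unit) -scalerA cv0 scaler0.
Qed.

Lemma relation_perm (R : nzRingType) (V : lmodType R) (X : {fset V})
    (s : {perm X}) (a : X -> R) :
  extends_to_linear_aut s ->
  \sum_x a x *: fsval x = 0 -> \sum_x a x *: fsval (s x) = 0.
Proof.
case=> u [_ us] /(congr1 u); rewrite raddf0 raddf_sum => ua0.
rewrite -[RHS]ua0; apply: eq_bigr => x _.
by rewrite -us; apply/esym; exact: linearZZ.
Qed.

Lemma relation_const (R : unitRingType) (divR : division_ring R)
    (V : lmodType R) (X : {fset V}) (a : X -> R) :
  (forall s : {perm X}, extends_to_linear_aut s) ->
  \sum_x a x *: fsval x = 0 -> forall p q, a p = a q.
Proof.
move=> extX a0 p q; have [-> //|p_neq_q] := eqVneq p q.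
have as0 := relation_perm (extX (tperm p q)) a0.
have : \sum_x a x *: (fsval (tperm p q x) - fsval x) = 0.
  under eq_bigr do rewrite scalerBr.
  by rewrite sumrB as0 a0 subr0.
(* The transposition fixes every other vector, so only the terms at [p] and [q] survive; they are
   opposite multiples of the nonzero vector [q - p]. *)
rewrite (bigD1 p) //= (bigD1 q) 1?eq_sym //= big1 => [|x /andP[xp xq]]; last first.
  by rewrite tpermD 1?eq_sym // subrr scaler0.
rewrite tpermL tpermR addr0 -[fsval p - _]opprB scalerN -scalerBl.
move=> /(division_ring_scaler_eq0 divR) apq.
apply/eqP; rewrite -subr_eq0; apply/eqP/apq.
by rewrite subr_eq0 (inj_eq val_inj) eq_sym.
Qed.

Lemma lin_indep_setC1 (R : nzRingType) (V : lmodType R) (I : finType)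
    (x : I -> V) (i0 : I) :
  (forall a : I -> R, \sum_i a i *: x i = 0 -> forall i j, a i = a j) ->
  lin_indep (fun k : 'I_#|[set~ i0]| => x (enum_val k)).
Proof.
move=> x_const a a0 k.
(* Extension of [a] by zero: since [enum_val] is injective, this sum has a single term when [i]
   differs from [i0], and it is empty at [i0]. *)
pose b i := \sum_(k | enum_val k == i :> I) a k.
have b_val j : b (enum_val j) = a j.
  by rewrite /b (big_pred1 j) // => k'; rewrite /= (inj_eq enum_val_inj).
have b_i0 : b i0 = 0.
  rewrite /b big_pred0 // => j; apply/negbTE.
  by have := enum_valP j; rewrite !inE.
(* Once [b] is known to be a relation, its constant value is read off at [i0]. *)
rewrite -b_val -[RHS]b_i0; apply: x_const.
rewrite -[RHS]a0 [RHS](partition_big (fun j => enum_val j) predT) //=.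
apply: eq_bigr => i _; rewrite scaler_suml.
by apply: eq_bigr => j /eqP ->.
Qed.

Theorem theorem1 (R : unitRingType) (divR : division_ring R)
    (V : vectType R) (n : nat) (dimV : dim V = n) (n_ge2 : (2 <= n)%N)
    (X : {fset V}) (X_gt1 : (1 < #|` X|)%N)
    (extX : forall s : {perm X}, extends_to_linear_aut s) :
  lin_indep_fset X \/
  exists (m : nat) (x : 'I_m -> V),
    lin_indep x /\
    X = ([fset x i | i : 'I_m] `|` [fset (- \sum_(i < m) x i)%R])%fset.
Proof.
have [sumX0|sumX_neq0] := eqVneq (\sum_(x : X) fsval x) 0; last first.
  left=> a a0 p; have aE := relation_const divR extX a0.
  (* The common coefficient factors out: [a p] times the sum of [X] is the given relation. *)
  apply: (division_ring_scaler_eq0 divR) sumX_neq0.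
  by rewrite scaler_sumr -[RHS]a0; apply: eq_bigr => x _; rewrite (aE p x).
right; have /fset0Pn[v vX] : X != fset0 by rewrite -cardfs_gt0 ltnW.
pose x0 : X := [` vX]%fset.
exists #|[set~ x0]|, (fun k => fsval (enum_val k)); split.
  by apply: lin_indep_setC1 => a; apply: relation_const.
(* The choice of [x0] is arbitrary: as [X] sums to zero, any of its vectors is the opposite of the
   sum of the others. *)
have -> : - \sum_(k < #|[set~ x0]|) fsval (enum_val k) = fsval x0.
  apply/eqP; rewrite eq_sym -addr_eq0 -(big_enum_val (fun x : X => fsval x)).
  rewrite -[X in _ == X]sumX0 [X in _ == X](bigD1 x0) //=.
  apply/eqP; congr (_ + _).
  by apply: eq_bigl => x; rewrite !inE.
apply/fsetP=> w; rewrite !inE; apply/idP/orP => [wX|[/imfsetP[k _ ->]|/eqP->]].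
- have [/(congr1 val)/= ->|w_neq] := eqVneq ([` wX]%fset : X) x0.
    by right.
  (* [wA] also shows that the index type is inhabited, as [enum_rank_in] requires. *)
  left; have wA : ([` wX]%fset : X) \in [set~ x0] by rewrite !inE.
  apply/imfsetP; exists (enum_rank_in wA [` wX]%fset) => //.
  by rewrite enum_rankK_in.
- exact: fsvalP.
- exact: fsvalP.
Qed.
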